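(* Let $\mu\in\mathbb{R}$, $0\le\rho\le 1$, timestep $k>0$ and grid spacing $h>0$. Consider the Milstein finite difference scheme $$v_j^{n+1} = v_j^n - \frac{\mu k + \sqrt{\rho k}\, Z_n}{2h}\left(v_{j+1}^n - v_{j-1}^n\right) + \frac{(1-\rho) k + \rho k Z_n^2}{2h^2}\left(v_{j+1}^n - 2 v_j^n + v_{j-1}^n\right),$$ where $Z_0,Z_1,\dots$ are independent standard normal random variables. If $$\mu^2 k \le 1-\rho \qquad\text{and}\qquad \frac{k}{h^2}\le (1+2\rho^2)^{-1},$$ then the scheme is stable in the mean-square sense, i.e. for every $\theta\in[-\pi,\pi]$, every Fourier mode solution $v_j^n = g_n \exp(i j\theta)$ satisfies $\mathbb{E}[|g_{n+1}|^2]\le \mathbb{E}[|g_n|^2]$ for all $n\ge 0$.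
   Context: The scheme discretises the SPDE $\mathrm{d}v = -\mu\, v_x\,\mathrm{d}t + \tfrac12 v_{xx}\,\mathrm{d}t - \sqrt{\rho}\, v_x\,\mathrm{d}M_t$ with $M$ a standard Brownian motion; $v_j^n$ approximates $v(nk,jh)$ and $M_{(n+1)k}-M_{nk}=\sqrt{k}\,Z_n$. Mean-square stability is in the sense of Fourier (von Neumann) analysis: boundary conditions are ignored ($j\in\mathbb{Z}$), and one considers modes $v_j^n=g_n\exp(ij\theta)$, where $g_0$ is a deterministic complex number and the random complex amplitude $g_n$ evolves by the recursion obtained by inserting the mode into the scheme. *)

(* Defs.v *)
From HB Require Import structures.
From mathcomp Require Import all_boot all_order all_algebra finmap.
From mathcomp Require Import all_classical all_reals all_analysis.
From mathcomp Require Export complex.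
Set Implicit Arguments.
Unset Strict Implicit.
Unset Printing Implicit Defensive.
Import Order.TTheory GRing.Theory Num.Theory.
Import numFieldNormedType.Exports.
Local Open Scope classical_set_scope.
Local Open Scope ring_scope.
Local Open Scope complex_scope.

Definition mutually_independent d (T : measurableType d) (R : realType)
    (P : probability T R) (I : choiceType) (X : I -> {RV P >-> R}) : Prop :=
  forall (J : {fset I}) (B : I -> set R),
    (forall i, i \in J -> measurable (B i)) ->
    (P (\bigcap_(i in [set` J]) (X i @^-1` B i)) =
      \prod_(i <- J) P (X i @^-1` B i))%E.

Definition standard_normal d (T : measurableType d) (R : realType)
    (P : probability T R) (X : {RV P >-> R}) : Prop :=
  forall A : set R, measurable A -> distribution P X A = normal_prob 0 1 A.

(* exp (i x) for real x *)
Definition expi (R : realType) (x : R) : R[i] := cos x +i* sin x.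

Definition milstein_step (R : realType) (mu rho k h z : R)
    (v : int -> R[i]) (j : int) : R[i] :=
  v j
  - ((mu * k + Num.sqrt (rho * k) * z) / (2 * h))%:C
      * (v (j + 1) - v (j - 1))
  + (((1 - rho) * k + rho * k * z ^+ 2) / (2 * h ^+ 2))%:C
      * (v (j + 1) - 2 * v j + v (j - 1)).

Definition milstein_solution d (T : measurableType d) (R : realType)
    (P : probability T R) (mu rho k h : R) (Z : nat -> {RV P >-> R})
    (v : nat -> int -> T -> R[i]) : Prop :=
  forall (n : nat) (j : int) (w : T),
    v n.+1 j w = milstein_step mu rho k h (Z n w) (fun l => v n l w) j.

Definition fourier_mode (T : Type) (R : realType) (theta : R)
    (g : nat -> T -> R[i]) (n : nat) (j : int) (w : T) : R[i] :=
  g n w * expi (j%:~R * theta).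

(* No measurability is asked of [g]: the recursion and the deterministic [g 0]
   make every [g n] a polynomial in the random variables [Z m], m < n. *)
Definition mean_square_stable d (T : measurableType d) (R : realType)
    (P : probability T R) (mu rho k h : R) (Z : nat -> {RV P >-> R}) : Prop :=
  forall theta : R, - pi <= theta <= pi ->
  forall g : nat -> T -> R[i],
    (exists c : R[i], forall w, g 0%N w = c) ->
    milstein_solution mu rho k h Z (fourier_mode theta g) ->
    forall n : nat,
      ('E_P[fun w => (Normc.normc (g n.+1 w) ^+ 2)%R]
       <= 'E_P[fun w => (Normc.normc (g n w) ^+ 2)%R])%E.

(* Main.v *)
Require Import Defs.
From HB Require Import structures.
From mathcomp Require Import all_boot all_order all_algebra finmap.
From mathcomp Require Import all_classical all_reals all_analysis measurable_realfun.
From mathcomp Require Import ring lra.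
Set Implicit Arguments.
Unset Strict Implicit.
Unset Printing Implicit Defensive.
Import Order.TTheory GRing.Theory Num.Theory.
Import numFieldNormedType.Exports.
Local Open Scope classical_set_scope.
Local Open Scope ring_scope.

(* Inserting the mode into the scheme gives [g_(n+1) = A(Z_n) g_n], where
   [|A(z)|^2] is a quartic polynomial in [z].  By independence
   [E|g_n|^2 = |g_0|^2 M^n] with [M = E|A(Z)|^2], and the Gaussian moments give
   [M = 1 - 2 l q + l^2 q^2 (1 + 2 rho^2) + l (mu^2 k + rho) sin(theta)^2],
   [l = k / h^2], [q = 1 - cos theta].  The two hypotheses bound the last two
   terms by [l q^2] and [l sin(theta)^2 = l q (2 - q)], so that [M <= 1]. *)

(** * Weighted image measures and products of independent variables *)

Import HBNNSimple.

(** The identity on sets makes [nu] the image under [X] of the measure with density [g]. It is the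
    claim for indicators; linearity gives simple functions and monotone convergence the rest. One
    use takes [g] as a Gaussian density, another as a product of independent factors. *)
Lemma ge0_integral_weighted d d' (T : measurableType d) (T' : measurableType d')
    (R : realType) (m : {measure set T -> \bar R})
    (nu : {measure set T' -> \bar R}) (X : T -> T')
    (g : T -> R) (f : T' -> R) :
  measurable_fun setT X ->
  measurable_fun setT g -> (forall w, 0 <= g w) ->
  (forall B, measurable B -> (\int[m]_(w in X @^-1` B) (g w)%:E = nu B)%E) ->
  measurable_fun setT f -> (forall y, 0 <= f y) ->
  (\int[m]_w (f (X w) * g w)%:E = \int[nu]_y (f y)%:E)%E.
Proof.
move=> mX mg g0 gnu mf f0.
have mef : measurable_fun setT (EFin \o f) by exact/measurable_EFinP.
pose s := nnsfun_approx measurableT mef.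
have sf y : (s n y)%:E @[n --> \oo] --> (f y)%:E.
  by apply: cvg_nnsfun_approx => // x _; rewrite /= lee_fin.
have s_nd y : {homo (fun n => s n y) : p q / (p <= q)%N >-> p <= q}.
  by move=> p q pq; exact/lefP/nd_nnsfun_approx.
have msX n : measurable_fun setT (fun w => s n (X w)).
  by apply: measurableT_comp.
have step n : (\int[m]_w (s n (X w) * g w)%:E = \int[nu]_y (s n y)%:E)%E.
  have mXr r : measurable (X @^-1` (s n @^-1` [set r])).
    by rewrite -[X in measurable X]setTI; exact: mX.
  (* Both integrals split over the finitely many values [r] of the simple function, which leaves one
     level set at a time. *)
  transitivity (\int[m]_w (\sum_(r \in range (s n))
      (r * \1_(s n @^-1` [set r]) (X w) * g w)%:E))%E.
    apply: eq_integral => w _; rewrite fimfunE EFinM -fsumEFin//.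
    rewrite ge0_mule_fsuml; last by move=> r; exact: nnfun_muleindic_ge0.
    by apply: eq_fsbigr => r _; rewrite EFinM.
  transitivity (\int[nu]_y (\sum_(r \in range (s n))
      (r * \1_(s n @^-1` [set r]) y)%:E))%E; last first.
    by apply: eq_integral => y _; rewrite [in RHS]fimfunE -fsumEFin.
  have mind r : measurable_fun setT (fun w => \1_(s n @^-1` [set r]) (X w) : R).
    have mi : measurable_fun setT (\1_(s n @^-1` [set r]) : T' -> R) by [].
    exact: (measurableT_comp mi mX).
  rewrite ge0_integral_fsum//; last 2 first.
  - by move=> r; apply/measurable_EFinP; do 2 apply: measurable_funM => //.
  - move=> r w _; rewrite EFinM mule_ge0 ?lee_fin//.
    exact: (nnfun_muleindic_ge0 (s n) r (X w)).
  rewrite ge0_integral_fsum//; last 2 first.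
  - by move=> r; apply/measurable_EFinP; apply: measurable_funM.
  - by move=> r y _; exact: nnfun_muleindic_ge0.
  apply: eq_fsbigr => r; rewrite inE => -[y0 _ sr].
  have r0 : 0 <= r by rewrite -sr.
  under eq_integral do rewrite -mulrA EFinM.
  under [RHS]eq_integral do rewrite EFinM.
  rewrite !ge0_integralZl//; last 3 first.
  - exact/measurable_EFinP.
  - by apply/measurable_EFinP; exact: measurable_funM.
  - by move=> w _; rewrite lee_fin mulr_ge0.
  rewrite integral_indic// setIT -gnu// [in RHS]integral_mkcond.
  congr (_ * _)%E; apply: eq_integral => w _.
  by rewrite epatch_indic/= muleC EFinM.
have cvnu : (\int[nu]_y (s n y)%:E)%E @[n --> \oo] --> (\int[nu]_y (f y)%:E)%E.
  rewrite (_ : (\int[nu]_y (f y)%:E)%E =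
      (\int[nu]_y limn (fun n => (s n y)%:E))%E); last first.
    by apply: eq_integral => y _; apply/esym/cvg_lim.
  apply: cvg_monotone_convergence => //.
  - by move=> n; exact/measurable_EFinP/measurable_funP.
  - by move=> n y _; rewrite lee_fin.
  - by move=> y _ p q pq; rewrite lee_fin; exact: s_nd.
have cvm : (\int[m]_w (s n (X w) * g w)%:E)%E @[n --> \oo] -->
    (\int[m]_w (f (X w) * g w)%:E)%E.
  rewrite (_ : (\int[m]_w (f (X w) * g w)%:E)%E =
      (\int[m]_w limn (fun n => (s n (X w) * g w)%:E))%E); last first.
    apply: eq_integral => w _; apply/esym/cvg_lim => //.
    have : ((s n (X w))%:E * (g w)%:E)%E @[n --> \oo] -->
        ((f (X w))%:E * (g w)%:E)%E by exact: cvgeZr.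
    by [].
  apply: cvg_monotone_convergence => //.
  - by move=> n; apply/measurable_EFinP; exact: measurable_funM.
  - by move=> n w _; rewrite lee_fin mulr_ge0.
  - by move=> w _ p q pq; rewrite lee_fin ler_wpM2r//; exact: s_nd.
move: cvm; under eq_cvg do rewrite step; move=> cvm.
exact: cvg_unique cvm cvnu.
Qed.

(** Independence is given for events only; this extension to functions turns the second moment of
    [g n] into a product of one-step means. The means [e i] are real, so that their product can
    scale a measure. *)
Lemma expectation_prod_independent d (T : measurableType d) (R : realType)
    (P : probability T R) (I : choiceType) (X : I -> {RV P >-> R})
    (f : I -> R -> R) (e : I -> R) (J : {fset I}) :
  mutually_independent X ->
  (forall i, measurable_fun setT (f i)) -> (forall i x, 0 <= f i x) ->
  (forall i, 'E_P[fun w => f i (X i w)] = (e i)%:E)%E ->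
  ('E_P[fun w => (\prod_(i <- J) f i (X i w))%R] = (\prod_(i <- J) e i)%:E)%E.
Proof.
move=> Xindep mf f0 fe.
suff [K] : exists K : seq I, forall i, i \in J -> i \notin K ->
    exists2 B, measurable B & f i = \1_B.
  (* The factors indexed by [K] are turned into indicators one at a time;
     independence is the case where all of them are indicators. *)
  elim: K f e mf f0 fe => [|i K IH] f e mf f0 fe fK.
    (* An indicator determines its set as the preimage of 1, which yields a single family [B]
       without choosing witnesses. *)
    pose B i := f i @^-1` [set 1].
    have mB i : measurable (B i) by rewrite -[X in measurable X]setTI; exact: mf.
    have fB i : i \in J -> f i = \1_(B i).
      move=> iJ; have [A _ fA] := fK i iJ isT; apply/funext => x.
      suff -> : B i = A by rewrite fA.
      rewrite /B fA; apply/seteqP; split=> y /=; rewrite indicE.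
        by case: (boolP (y \in A)) => [|_ /eqP]; rewrite ?inE// eq_sym oner_eq0.
      by move=> Ay; rewrite mem_set.
    have -> : (fun w => \prod_(i <- J) f i (X i w)) =
        \1_(\bigcap_(i in [set` J]) (X i @^-1` B i)) :> (T -> R).
      apply/funext => w; rewrite indicE.
      case: (boolP (w \in _)) => [|/negP]; rewrite inE => wB.
        rewrite big_seq big1// => i iJ; rewrite fB// indicE mem_set//.
      have [i iJ Bi] : exists2 i, i \in J & ~ B i (X i w).
        apply: contra_notP wB => wB i iJ /=; apply: contrapT => Bi.
        by apply: wB; exists i.
      by rewrite (big_fsetD1 i)//= fB// indicE memNset// mul0r.
    rewrite expectation_indic; last first.
      apply: fin_bigcap_measurable => [|i _]; first exact: finite_fset.
      exact: measurable_funPTI.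
    rewrite Xindep// -prodEFin [LHS]big_seq [RHS]big_seq.
    apply: eq_bigr => i iJ; rewrite -fe fB//.
    by rewrite -expectation_indic//; exact: measurable_funPTI.
  have [iJ|iJ] := boolP (i \in J); last first.
    apply: IH => // j jJ jK; apply: fK => //; rewrite inE negb_or jK andbT.
    by apply: contraNneq iJ => <-.
  have e0 j : 0 <= e j by rewrite -lee_fin -fe; apply: expectation_ge0.
  pose G w := \prod_(j <- (J `\ i)%fset) f j (X j w).
  have G0 w : 0 <= G w by apply: prodr_ge0.
  have mfX j : measurable_fun setT (fun w => f j (X j w)).
    by apply: measurableT_comp => //; exact: measurable_funP.
  have mG : measurable_fun setT G by apply: measurable_prod.
  have c0 : 0 <= \prod_(j <- (J `\ i)%fset) e j by apply: prodr_ge0.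
  (* The induction hypothesis, with factor [i] replaced by [\1_B], shows that weighting [P] by the
     other factors [G] only rescales the law of [X i]. The weighted change of variables then
     restores [f i]. *)
  have GB B : measurable B -> (\int[P]_(w in X i @^-1` B) (G w)%:E =
      mscale (NngNum c0) (distribution P (X i)) B)%E.
    move=> mB; pose f' j := if j == i then \1_B else f j.
    pose e' j := if j == i then fine (P (X i @^-1` B)) else e j.
    have mXB : measurable (X i @^-1` B) by exact: measurable_funPTI.
    have f'i : f' i = \1_B by rewrite /f' eqxx.
    have e'i : e' i = fine (P (X i @^-1` B)) by rewrite /e' eqxx.
    have f'D j : j \in (J `\ i)%fset -> f' j = f j.
      by rewrite !inE /f' => /andP[/negbTE ->].
    have e'D j : j \in (J `\ i)%fset -> e' j = e j.
      by rewrite !inE /e' => /andP[/negbTE ->].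
    transitivity ('E_P[fun w => (\prod_(j <- J) f' j (X j w))%R])%E.
      rewrite unlock [LHS]integral_mkcond; apply: eq_integral => w _.
      rewrite epatch_indic (big_fsetD1 i)//= f'i -EFinM mulrC; congr (_ * _)%:E.
      by apply: eq_big_seq => j /f'D ->.
    rewrite (IH _ e'); first last.
    - move=> j jJ jK; rewrite /f'; case: eqVneq => [_|ji]; first by exists B.
      by apply: fK => //; rewrite inE negb_or ji.
    - move=> j; rewrite /f' /e'; case: eqVneq => [->|_]; last exact: fe.
      by rewrite fineK ?fin_num_measure// -expectation_indic.
    - by move=> j x; rewrite /f'; case: eqVneq.
    - by move=> j; rewrite /f'; case: eqVneq.
    rewrite (big_fsetD1 i)//= e'i EFinM fineK ?fin_num_measure// muleC.
    rewrite /mscale/=; congr (_%:E * _)%E.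
    by apply: eq_big_seq => j /e'D ->.
  have mXi : measurable_fun setT (X i) by exact: measurable_funP.
  have := ge0_integral_weighted mXi mG G0 GB (mf i) (f0 i).
  rewrite ge0_integral_mscale//; last 2 first.
  - exact/measurable_EFinP.
  - by move=> y _; rewrite lee_fin.
  rewrite ge0_integral_distribution//; last 2 first.
  - exact/measurable_EFinP.
  - by move=> y; rewrite lee_fin.
  have := fe i; rewrite unlock /= => -> GE.
  rewrite (big_fsetD1 i)//= EFinM muleC -GE.
  by apply: eq_integral => w _; rewrite (big_fsetD1 i).
(* With [K] listing all of [J], no factor is required to be an indicator. *)
by exists (enum_fset J) => i ->.
Qed.

(** * Gaussian mean of a quartic polynomial *)

(** From [exp y >= 1 + y^2 / 2] at [y = x^2 / 2]. Quartic decay is enough to beat the cubic boundary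
    terms below. *)
Lemma expR_sqr_le (R : realType) (x : R) : 0 < x ->
  expR (- (x ^+ 2 / 2)) <= 8 / x ^+ 4.
Proof.
move=> x0; have x20 : 0 <= x ^+ 2 / 2 by rewrite divr_ge0// sqr_ge0.
have := expR_ge1Dxn 1 x20; rewrite expRN => H.
have x4 : 0 < x ^+ 4 / 8 by rewrite divr_gt0 ?exprn_gt0.
rewrite -[leRHS]invf_div lef_pV2 ?posrE ?expR_gt0//.
apply: le_trans H; rewrite (_ : (_ / 2) ^+ 2 / _ = x ^+ 4 / 8); first lra.
by rewrite !factS fact0; by field.
Qed.

(** The moments of orders 1, 2 and 4 are 0, 1 and 3. All are found at once by the fundamental
    theorem of calculus on growing symmetric intervals; positivity of [p] justifies the limit. *)
Lemma integral_normal_quartic (R : realType) (a b c e : R) :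
  let p := fun x : R => a + b * x + c * x ^+ 2 + e * x ^+ 4 in
  (forall x, 0 <= p x) ->
  (\int[lebesgue_measure]_x (p x * normal_pdf 0 1 x)%:E = (a + c + 3 * e)%:E)%E.
Proof.
move=> p p0; set K := a + c + 3 * e; set phi := normal_pdf (0 : R) 1.
(* This polynomial solves q' - x q = K - p, to be combined with phi' = - x phi. *)
pose q x : R := b + c * x + e * (x ^+ 3 + 3 * x).
have phiE x : phi x = normal_peak 1 * expR (- (x ^+ 2 / 2)).
  rewrite /phi normal_pdfE ?oner_neq0// /normal_fun subr0 expr1n.
  by rewrite mulNr.
have dphi (t : R) : is_derive t (1 : R) phi (- t * phi t).
  rewrite (_ : phi = fun x => normal_peak 1 * expR (- (x ^+ 2 / 2))); last first.
    exact/funext.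
  apply: is_derive_eq => //=.
  rewrite /GRing.scale/=. by field.
(* [F] is an antiderivative of [(p - K) phi], where [K] is the Gaussian mean
   of [p]; it vanishes at infinity. *)
pose F x : R := - (q x * phi x).
have dF (t : R) : is_derive t (1 : R) F (p t * phi t - K * phi t).
  by apply: is_derive_eq; rewrite /GRing.scale/= /p /K /q; ring.
have cphi : continuous phi by apply: continuous_normal_pdf; exact: oner_neq0.
have mphi := measurable_normal_pdf (0 : R) 1.
have cp : continuous p.
  by move=> x; apply: differentiable_continuous; apply/derivable1_diffP.
have mp : measurable_fun setT p by exact: continuous_measurable_fun.
have phi0 x : 0 <= phi x by exact: normal_pdf_ge0.
(* The shift to [n.+1] keeps the interval nondegenerate at [n = 0] and gives endpoints of size at
   least 1 for the tail bound. *)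
pose I n : set R := [set` `[- n.+1%:R, n.+1%:R] ].
have FTC n : (\int[lebesgue_measure]_(x in I n) (p x * phi x)%:E =
    (F n.+1%:R - F (- n.+1%:R))%:E +
    K%:E * \int[lebesgue_measure]_(x in I n) (phi x)%:E)%E.
  have lt_I : - n.+1%:R < n.+1%:R :> R by rewrite gtrN.
  have cpphi : continuous (fun x => p x * phi x - K * phi x).
    move=> x; apply: cvgB; first exact: (cvgM (cp x) (cphi x)).
    exact: (cvgM (cvg_cst _) (cphi x)).
  have cF : continuous F.
    by move=> x; apply: differentiable_continuous; apply/derivable1_diffP.
  have <- : (\int[lebesgue_measure]_(x in I n) (p x * phi x - K * phi x)%:E =
      (F n.+1%:R - F (- n.+1%:R))%:E)%E.
    rewrite EFinB; apply: continuous_FTC2 => //.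
    - exact: continuous_subspaceT.
    - split=> [x _| |] //; [exact: cvg_at_right_filter (cF _)
                           |exact: cvg_at_left_filter (cF _)].
    - by move=> x _; rewrite derive1E; exact: derive_val.
  have int_I (f : R -> R) : continuous f ->
      lebesgue_measure.-integrable (I n) (EFin \o f).
    move=> cf; apply: continuous_compact_integrable; first exact: segment_compact.
    exact: continuous_subspaceT.
  rewrite -integralZl//; last exact: (int_I phi).
  rewrite -integralD//.
  - by apply: eq_integral => x _; rewrite -EFinM -EFinD subrK.
  - exact: measurable_itv.
  - exact: (int_I (fun x => p x * phi x - K * phi x)).
  - by apply: (int_I (fun x => K * phi x)) => x; exact: (cvgM (cvg_cst _) (cphi x)).
  - exact: measurable_itv.
have nd_I : nondecreasing_seq I.
  move=> i j ij; rewrite subsetEset; apply: subset_itv; rewrite bnd_simp.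
    by rewrite lerN2 ler_nat.
  by rewrite ler_nat.
have I_T : \bigcup_n I n = setT.
  apply/seteqP; split=> // x _; exists (Num.truncn `|x|) => //.
  by rewrite /I /= in_itv/= -ler_norml ltW// truncnS_gt.
have cvg_I (f : R -> R) : measurable_fun setT f -> (forall x, 0 <= f x) ->
    (\int[lebesgue_measure]_(x in I n) (f x)%:E)%E @[n --> \oo] -->
    (\int[lebesgue_measure]_x (f x)%:E)%E.
  move=> mf f0; rewrite -[X in integral _ X]I_T.
  apply: ge0_nondecreasing_set_cvg_integral => //.
  - by move=> n; exact: measurable_itv.
  - by move=> n; apply/measurable_funTS/measurable_EFinP.
  - by move=> n x _; rewrite lee_fin.
have cvF : (F n.+1%:R - F (- n.+1%:R)) @[n --> \oo] --> (0 : R).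
  (* The even part [b] of [q] cancels in the difference. The odd part is at most
     [2 (|c| + 4 |e|) x^3] for [x >= 1], and the density at most [8 normal_peak 1 / x^4]; the
     product is [D / x]. *)
  pose D := 16 * normal_peak 1 * (`|c| + 4 * `|e|) : R.
  have cvD : D * harmonic n @[n --> \oo] --> (0 : R).
    by rewrite -[X in _ --> X](mulr0 D); apply: cvgM; [exact: cvg_cst|exact: cvg_harmonic].
  apply: (@squeeze_cvgr _ _ _ _ (fun n => - (D * harmonic n)) (fun n => D * harmonic n)) => //.
    near=> n; rewrite -ler_norml /harmonic/=.
    set x : R := n.+1%:R; have x1 : 1 <= x by rewrite ler1n.
    have x0 : 0 < x by lra.
    have pk0 := @normal_peak_ge0 R 1.
    rewrite (_ : F x - F (- x) = - (2 * (c * x + e * (x ^+ 3 + 3 * x)) * phi x)); last first.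
      by rewrite /F /q !phiE sqrrN; ring.
    rewrite normrN normrM (ger0_norm (phi0 x)).
    have phix : phi x <= normal_peak 1 * (8 / x ^+ 4).
      by rewrite phiE ler_wpM2l// expR_sqr_le.
    have xx3 : x <= x ^+ 3.
      by rewrite -[leLHS]expr1 ler_weXn2l.
    have qx : `|2 * (c * x + e * (x ^+ 3 + 3 * x))| <= 2 * (`|c| + 4 * `|e|) * x ^+ 3.
      rewrite normrM ger0_norm// -mulrA ler_pM2l//.
      rewrite (le_trans (ler_normD _ _))// !normrM (gtr0_norm x0).
      rewrite (@ger0_norm _ (_ + _)); last by rewrite addr_ge0 ?exprn_ge0 ?mulr_ge0 ?(ltW x0).
      have := normr_ge0 c; have := normr_ge0 e.
      nra.
    apply: (le_trans (ler_pM _ _ qx phix)) => //.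
    rewrite le_eqVlt; apply/orP; left; apply/eqP.
    by rewrite /D; field; rewrite gt_eqF.
  by rewrite -[X in _ --> X]oppr0; exact: cvgN.
have cv1 := cvg_I (fun x => p x * phi x) (measurable_funM mp mphi)
  (fun x => mulr_ge0 (p0 x) (phi0 x)).
have cv2 : ((F n.+1%:R - F (- n.+1%:R))%:E +
    K%:E * \int[lebesgue_measure]_(x in I n) (phi x)%:E)%E @[n --> \oo] --> K%:E.
  rewrite -[X in _ --> X]add0e -[X in _ --> (_ + X)%E]mule1.
  apply: cvgeD => //; first exact: cvg_EFin (nearW _ _) cvF.
  apply: cvgeZl => //; rewrite -(integral_normal_pdf (0 : R) 1); exact: cvg_I.
move: cv1; under eq_cvg do rewrite FTC.
by move=> cv1; exact: cvg_unique cv1 cv2.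
Unshelve. all: by end_near. Qed.

Lemma expectation_normal_quartic d (T : measurableType d) (R : realType)
    (P : probability T R) (Z : {RV P >-> R}) (a b c e : R) :
  standard_normal Z ->
  let p := fun x : R => a + b * x + c * x ^+ 2 + e * x ^+ 4 in
  (forall x, 0 <= p x) ->
  ('E_P[fun w => p (Z w)] = (a + c + 3 * e)%:E)%E.
Proof.
move=> Zn p p0; rewrite -(@integral_normal_quartic R a b c e)//.
have mp : measurable_fun setT p.
  apply: continuous_measurable_fun => x.
  by apply: differentiable_continuous; apply/derivable1_diffP.
have mphi := measurable_normal_pdf (0 : R) 1.
have mid : measurable_fun setT (idfun : R -> R) by exact: measurable_id.
(* Here the map is the identity: the law of [Z] is Lebesgue measure weighted by the normal
   density. *)
have := @ge0_integral_weighted _ _ _ _ R lebesgue_measure (distribution P Z)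
  idfun (normal_pdf 0 1) p mid mphi (@normal_pdf_ge0 _ _ _).
move=> -> //; last by move=> B mB; exact/esym/Zn.
by rewrite unlock ge0_integral_distribution//; exact/measurable_EFinP.
Qed.

(** * The one-step amplification factor *)

(* [|A z|^2], where the scheme multiplies the mode by the complex factor [A z]
   when the normal increment is [z]. *)
Definition milstein_gain2 (R : realType) (mu rho k h theta z : R) : R :=
  (1 - ((1 - rho) * k + rho * k * z ^+ 2) / h ^+ 2 * (1 - cos theta)) ^+ 2 +
  ((mu * k + Num.sqrt (rho * k) * z) / h * sin theta) ^+ 2.

(** At the node [j = 0] the mode is the amplitude itself. Its neighbours carry the factors
    [expi theta] and [expi (- theta)], so the first difference multiplies by [2 i sin theta] and the
    second by [- 2 (1 - cos theta)]. *)
Lemma normc_milstein_mode d (T : measurableType d) (R : realType)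
    (P : probability T R) (mu rho k h : R) (Z : nat -> {RV P >-> R})
    (theta : R) (g : nat -> T -> R[i]) (h0 : h != 0) :
  milstein_solution mu rho k h Z (fourier_mode theta g) ->
  forall n w, Normc.normc (g n.+1 w) ^+ 2 =
    Normc.normc (g n w) ^+ 2 * milstein_gain2 mu rho k h theta (Z n w).
Proof.
move=> sol n w; have := sol n 0 w.
rewrite /fourier_mode /milstein_step /expi !mul0r cos0 sin0.
rewrite add0r mul1r sub0r mulN1r cosN sinN.
set A := (X in (X%:C)%C). set B := (X in _ + (X%:C)%C * _).
case: (g n.+1 w) => x' y'; case: (g n w) => x y.
move=> /eqP; rewrite eq_complex /= => /andP[/eqP Ex /eqP Ey].
rewrite !sqr_sqrtr ?addr_ge0 ?sqr_ge0//.
(* Real and imaginary parts of the product with [1 - 2 B (1 - cos theta) - 2 i A sin theta]; the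
   cross terms cancel in the squared modulus. *)
have -> : x' = x * (1 - 2 * B * (1 - cos theta)) + 2 * A * y * sin theta by lra.
have -> : y' = y * (1 - 2 * B * (1 - cos theta)) - 2 * A * x * sin theta by lra.
by rewrite /milstein_gain2 /A /B; field.
Qed.

(* The left-hand side is the Gaussian mean of [milstein_gain2], with
   [q = 1 - cos theta] and [S = sin theta]. *)
Lemma milstein_gain_le1 (R : realType) (mu rho k h q S p r : R) :
  0 <= rho -> 0 < k -> 0 < h ->
  mu ^+ 2 * k <= 1 - rho -> k / h ^+ 2 <= (1 + 2 * rho ^+ 2)^-1 ->
  S ^+ 2 = q * (2 - q) ->
  p = 1 - k / h ^+ 2 * (1 - rho) * q -> r = k / h ^+ 2 * rho * q ->
  (p ^+ 2 + (S / h * (mu * k)) ^+ 2)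
  + (S ^+ 2 / h ^+ 2 * (rho * k) - 2 * p * r) + 3 * r ^+ 2 <= 1.
Proof.
move=> rho0 k0 h0 muk kh Sq -> ->.
have r1 : 0 < 1 + 2 * rho ^+ 2 by have := sqr_ge0 rho; lra.
have {}kh : k / h ^+ 2 * (1 + 2 * rho ^+ 2) <= 1 by rewrite -ler_pdivlMr// div1r.
have l0 : 0 < k / h ^+ 2 by rewrite divr_gt0 ?exprn_gt0.
have -> : (S / h * (mu * k)) ^+ 2 = k / h ^+ 2 * S ^+ 2 * (mu ^+ 2 * k).
  by field; rewrite gt_eqF.
have -> : S ^+ 2 / h ^+ 2 * (rho * k) = k / h ^+ 2 * S ^+ 2 * rho by ring.
set l := k / h ^+ 2 in kh l0 *.
have lS : 0 <= l * S ^+ 2 by rewrite mulr_ge0 ?sqr_ge0// ltW.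
(* Since [p - r = 1 - l q], the terms in [p] and [r] add up to [(1 - l q)^2 + 2 r^2]. Inserting the
   two scaled hypotheses leaves exactly 1. *)
have := ler_wpM2l lS muk.
have := ler_wpM2l (mulr_ge0 (ltW l0) (sqr_ge0 q)) kh.
rewrite Sq; nra.
Qed.

(** * Geometric evolution of the second moments *)

Theorem theorem2p1 (R : realType) (d : measure_display)
    (T : measurableType d) (P : probability T R)
    (mu rho k h : R) (Z : nat -> {RV P >-> R})
    (rho_ge0 : 0 <= rho) (rho_le1 : rho <= 1) (k_gt0 : 0 < k) (h_gt0 : 0 < h)
    (Z_indep : mutually_independent Z)
    (Z_normal : forall n, standard_normal (Z n))
    (mu_k : mu ^+ 2 * k <= 1 - rho)
    (k_h : k / h ^+ 2 <= (1 + 2 * rho ^+ 2)^-1) :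
  mean_square_stable mu rho k h Z.
Proof.
move=> theta _ g [c gc] sol.
have h0 : h != 0 by rewrite gt_eqF.
pose q := 1 - cos theta; pose S := sin theta; pose s := Num.sqrt (rho * k).
(* The first square in the gain is [(p - r z^2)^2], and [M] collects the constant, the quadratic and
   three times the quartic coefficient. *)
pose p := 1 - k / h ^+ 2 * (1 - rho) * q; pose r := k / h ^+ 2 * rho * q.
pose M := (p ^+ 2 + (S / h * (mu * k)) ^+ 2)
  + (S ^+ 2 / h ^+ 2 * (rho * k) - 2 * p * r) + 3 * r ^+ 2.
have s2 : s ^+ 2 = rho * k by rewrite sqr_sqrtr// mulr_ge0// ltW.
have gain_ge0 z : 0 <= milstein_gain2 mu rho k h theta z.
  by rewrite addr_ge0 ?sqr_ge0.
have gainE z : milstein_gain2 mu rho k h theta z =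
    (p ^+ 2 + (S / h * (mu * k)) ^+ 2) + (2 * (S / h) ^+ 2 * mu * k * s) * z
    + (S ^+ 2 / h ^+ 2 * (rho * k) - 2 * p * r) * z ^+ 2 + r ^+ 2 * z ^+ 4.
  have -> : S ^+ 2 / h ^+ 2 * (rho * k) = (S / h * s) ^+ 2.
    by rewrite !exprMn s2; field.
  by rewrite /milstein_gain2 -/s -/q -/S /p /r; field.
have mgain : measurable_fun setT (milstein_gain2 mu rho k h theta).
  apply: continuous_measurable_fun => x; rewrite (funext gainE).
  by apply: differentiable_continuous; apply/derivable1_diffP.
have EZ n : ('E_P[fun w => milstein_gain2 mu rho k h theta (Z n w)] = M%:E)%E.
  under [X in expectation _ X]eq_fun do rewrite gainE.
  by apply: expectation_normal_quartic => // x; rewrite -gainE.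
have M_le1 : M <= 1.
  apply: (@milstein_gain_le1 R mu rho k h q S) => //.
  by rewrite /S sin2cos2 /q; ring.
have M_ge0 : 0 <= M by rewrite -lee_fin -(EZ 0%N); exact: expectation_ge0.
have gE n w : Normc.normc (g n w) ^+ 2 = Normc.normc c ^+ 2 *
    \prod_(m <- iota 0 n) milstein_gain2 mu rho k h theta (Z m w).
  elim: n => [|n IHn]; first by rewrite big_nil mulr1 gc.
  rewrite (normc_milstein_mode h0 sol) IHn -mulrA; congr (_ * _).
  by rewrite -addn1 iotaD big_cat/= big_seq1 add0n.
have EgE n : ('E_P[fun w => (Normc.normc (g n w) ^+ 2)%R] =
    (Normc.normc c ^+ 2 * M ^+ n)%:E)%E.
  (* Independence is stated over finite sets, so the product over the list [iota 0 n] is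
     reindexed. *)
  pose J : {fset nat} := [fset m in iota 0 n]%fset.
  have iotaJ : perm_eq (iota 0 n) J.
    apply: uniq_perm => [||m]; first exact: iota_uniq.
      exact: fset_uniq.
    by rewrite in_fset.
  have mG : measurable_fun setT (fun w =>
      \prod_(m <- J) milstein_gain2 mu rho k h theta (Z m w)).
    apply: measurable_prod => m _.
    by apply: measurableT_comp => //; exact: measurable_funP.
  under [X in expectation _ X]eq_fun do rewrite gE (perm_big _ iotaJ)/=.
  rewrite unlock; under eq_integral do rewrite EFinM.
  rewrite ge0_integralZl//; last 3 first.
  - exact/measurable_EFinP.
  - by move=> w _; rewrite lee_fin prodr_ge0.
  - by rewrite lee_fin sqr_ge0.
  have := expectation_prod_independent J Z_indep (fun=> mgain) (fun=> gain_ge0) EZ.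
  rewrite unlock => ->.
  by rewrite -EFinM -(perm_big _ iotaJ)/= big_const_seq count_predT size_iota -Monoid.iteropE.
move=> n; rewrite !EgE lee_fin ler_wpM2l ?sqr_ge0//.
by rewrite exprS ler_piMl// exprn_ge0.
Qed.
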